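(* Let $\{B_l\}_{l\ge1}$ be the family of perfect crystals of type $D_4^{(3)}$ described in the context ($B_l$ of level $l$), let $$B_\infty=\{b=(\nu_1,\nu_2,\nu_3,\bar\nu_3,\bar\nu_2,\bar\nu_1)\in\mathbb{Z}^6\mid\nu_3\equiv\bar\nu_3\ (\mathrm{mod}\ 2)\}$$ with the crystal structure described in the context, and let $b_\infty=(0,0,0,0,0,0)$. Then $B_\infty$ with the element $b_\infty$ is a limit of $\{B_l\}_{l\ge1}$; that is, $\{B_l\}_{l\ge1}$ is a coherent family of perfect crystals.
   Context: **Affine data.** $D_4^{(3)}$ with index set $I=\{0,1,2\}$, Cartan matrix $(\langle h_i,\alpha_j\rangle)=\begin{pmatrix}2&-1&0\\-1&2&-3\\0&-1&2\end{pmatrix}$, canonical central element $c=h_0+2h_1+3h_2$, $P_{cl}=\bigoplus_i\mathbb{Z}\Lambda_i$ (the weight lattice modulo $\mathbb{Z}\delta$). **The crystals $B_l$.** $B_l$ is the set of $b=(x_1,x_2,x_3,\bar x_3,\bar x_2,\bar x_1)\in\mathbb{Z}_{\ge0}^6$ with $x_3\equiv\bar x_3\pmod2$ and $s(b)=x_1+x_2+\frac{x_3+\bar x_3}2+\bar x_2+\bar x_1\le l$. Write $(x)_+=\max(x,0)$. The operators are (only changed coordinates indicated; the result is $0$ if it is not in $B_l$): $\tilde e_1$: $\bar x_2\mapsto\bar x_2+1,\ \bar x_1\mapsto\bar x_1-1$ if $\bar x_2-\bar x_3\ge(x_2-x_3)_+$; $x_3\mapsto x_3+1,\ \bar x_3\mapsto\bar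 x_3-1$ if $\bar x_2-\bar x_3<0\le x_3-x_2$; $x_1\mapsto x_1+1,\ x_2\mapsto x_2-1$ if $(\bar x_2-\bar x_3)_+<x_2-x_3$. $\tilde f_1$: $x_1\mapsto x_1-1,\ x_2\mapsto x_2+1$ if $(\bar x_2-\bar x_3)_+\le x_2-x_3$; $x_3\mapsto x_3-1,\ \bar x_3\mapsto\bar x_3+1$ if $\bar x_2-\bar x_3\le0<x_3-x_2$; $\bar x_2\mapsto\bar x_2-1,\ \bar x_1\mapsto\bar x_1+1$ if $\bar x_2-\bar x_3>(x_2-x_3)_+$. $\tilde e_2$: $\bar x_3\mapsto\bar x_3+2,\ \bar x_2\mapsto\bar x_2-1$ if $\bar x_3\ge x_3$; $x_2\mapsto x_2+1,\ x_3\mapsto x_3-2$ if $\bar x_3<x_3$. $\tilde f_2$: $x_2\mapsto x_2-1,\ x_3\mapsto x_3+2$ if $\bar x_3\le x_3$; $\bar x_3\mapsto\bar x_3-2,\ \bar x_2\mapsto\bar x_2+1$ if $\bar x_3>x_3$. Put $z_1=\bar x_1-x_1$, $z_2=\bar x_2-\bar x_3$, $z_3=x_3-x_2$, $z_4=(\bar x_3-x_3)/2$, $A=(A_1,\dots,A_6)=(0,\ z_1,\ z_1+z_2,\ z_1+z_2+3z_4,\ z_1+z_2+z_3+3z_4,\ 2z_1+z_2+z_3+3z_4)$. $\tilde f_0$: let $k$ be the smallest index with $A_k=\max A$. $k=1$: $x_1\mapsto x_1+1$; $k=2$: $x_3\mapsto x_3+1,\bar x_3\mapsto\bar x_3+1,\bar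 x_1\mapsto\bar x_1-1$; $k=3$: $x_3\mapsto x_3+2,\bar x_2\mapsto\bar x_2-1$; $k=4$: $x_2\mapsto x_2+1,\bar x_3\mapsto\bar x_3-2$; $k=5$: $x_1\mapsto x_1+1,x_3\mapsto x_3-1,\bar x_3\mapsto\bar x_3-1$; $k=6$: $\bar x_1\mapsto\bar x_1-1$. $\tilde e_0$: let $k$ be the largest index with $A_k=\max A$. $k=1$: $x_1\mapsto x_1-1$; $k=2$: $x_3\mapsto x_3-1,\bar x_3\mapsto\bar x_3-1,\bar x_1\mapsto\bar x_1+1$; $k=3$: $x_3\mapsto x_3-2,\bar x_2\mapsto\bar x_2+1$; $k=4$: $x_2\mapsto x_2-1,\bar x_3\mapsto\bar x_3+2$; $k=5$: $x_1\mapsto x_1-1,x_3\mapsto x_3+1,\bar x_3\mapsto\bar x_3+1$; $k=6$: $\bar x_1\mapsto\bar x_1+1$. On $B_l$, $\varepsilon_i(b)=\max\{k\mid\tilde e_i^kb\ne0\}$, $\varphi_i(b)=\max\{k\mid\tilde f_i^kb\ne0\}$. For any of the crystals here $\varepsilon(b)=\sum_i\varepsilon_i(b)\Lambda_i$, $\varphi(b)=\sum_i\varphi_i(b)\Lambda_i$, $\mathrm{wt}\,b=\varphi(b)-\varepsilon(b)$. $B_l$ is a perfect crystal of level $l$; $(B_l)_{\min}=\{b\in B_l\mid\langle c,\varepsilon(b)\rangle=l\}$. **The crystal $B_\infty$.** $\tilde e_i,\tilde f_i$ ($i=0,1,2$) are given by the same rules with $x_i,\bar x_i$ replaced by $\nu_i,\bar\nu_i$,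 except that the result is never $0$ (negative coordinates are allowed and there is no restriction on $s(b)$). With the same replacement in $s$, $z_j$, $A$: $\varepsilon_1(b)=\bar\nu_1+(\bar\nu_3-\bar\nu_2+(\nu_2-\nu_3)_+)_+$, $\varphi_1(b)=\nu_1+(\nu_3-\nu_2+(\bar\nu_2-\bar\nu_3)_+)_+$, $\varepsilon_2(b)=\bar\nu_2+\frac12(\nu_3-\bar\nu_3)_+$, $\varphi_2(b)=\nu_2+\frac12(\bar\nu_3-\nu_3)_+$, $\varepsilon_0(b)=-s(b)+\max A-(2z_1+z_2+z_3+3z_4)$, $\varphi_0(b)=-s(b)+\max A$. **The crystals $T_\lambda\otimes B\otimes T_\mu$.** For $\lambda,\mu\in P_{cl}$ and a crystal $B$, $T_\lambda\otimes B\otimes T_\mu=\{t_\lambda\otimes b\otimes t_\mu\mid b\in B\}$ with $\tilde e_i,\tilde f_i$ acting on $b$ only, $\varepsilon_i(t_\lambda\otimes b\otimes t_\mu)=\varepsilon_i(b)-\langle h_i,\lambda\rangle$, $\varphi_i(t_\lambda\otimes b\otimes t_\mu)=\varphi_i(b)+\langle h_i,\mu\rangle$, $\mathrm{wt}(t_\lambda\otimes b\otimes t_\mu)=\lambda+\mu+\mathrm{wt}\,b$. **Limits and coherent families.** An embedding of crystals is an injective map preserving $\mathrm{wt},\varepsilon_i,\varphi_i$ and satisfying $f(\tilde e_ib)=\tilde e_if(b)$ whenever $\tilde e_ib\ne0$ and $f(\tilde f_ib)=\tilde f_if(b)$ whenever $\tilde f_ib\neq0$. Let $\{B_l\}_{l\ge1}$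 be a family of perfect crystals, $B_l$ of level $l$, and $J=\{(l,b)\mid l\in\mathbb{Z}_{>0},\ b\in(B_l)_{\min}\}$. A crystal $B_\infty$ with an element $b_\infty$ is a limit of $\{B_l\}_{l\ge1}$ if: (1) $\mathrm{wt}\,b_\infty=0$ and $\varepsilon(b_\infty)=\varphi(b_\infty)=0$; (2) for any $(l,b)\in J$ there is an embedding of crystals $f_{(l,b)}:T_{\varepsilon(b)}\otimes B_l\otimes T_{-\varphi(b)}\to B_\infty$ sending $t_{\varepsilon(b)}\otimes b\otimes t_{-\varphi(b)}$ to $b_\infty$; (3) $B_\infty=\bigcup_{(l,b)\in J}\operatorname{Im}f_{(l,b)}$. If a limit exists, $\{B_l\}$ is called a coherent family of perfect crystals. *)

(* Defs.v *)
From mathcomp Require Import all_boot all_order all_algebra.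
From mathcomp Require Import zify.

Set Implicit Arguments.
Unset Strict Implicit.
Unset Printing Implicit Defensive.

Import Order.TTheory GRing.Theory Num.Theory.
Local Open Scope ring_scope.

Definition posp (x : int) : int := Num.max x 0.

(* An element of the weight lattice modulo delta is the row of its
   coordinates in the basis Lambda_0, Lambda_1, Lambda_2; since
   <h_i, Lambda_j> = delta_ij, the pairing <h_i, la> is [la 0 i]. *)
Definition Pcl := 'rV[int]_3.

(* cartan i j = <h_i, alpha_j> *)
Definition cartan : 'M[int]_3 :=
  \matrix_(i, j) (nth [::] [:: [:: 2; -1; 0]; [:: -1; 2; -3]; [:: 0; -1; 2]] i)`_j.

(* alpha_j modulo delta *)
Definition alpha (j : 'I_3) : Pcl := \row_i cartan i j.

(* <c, la> for c = h_0 + 2 h_1 + 3 h_2 *)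
Definition pair_c (la : Pcl) : int := \sum_(i < 3) [:: 1; 2; 3]`_i * la 0 i.

(* The data of a crystal; [None] is the 0 of the crystal operators.  The value
   -oo of eps and phi is not needed for the crystals considered here. *)
Record crystal := Crystal {
  carrier :> Type;
  e : 'I_3 -> carrier -> option carrier;
  f : 'I_3 -> carrier -> option carrier;
  eps : 'I_3 -> carrier -> int;
  phi : 'I_3 -> carrier -> int;
  wt : carrier -> Pcl }.

Arguments e {c} i b.
Arguments f {c} i b.
Arguments eps {c} i b.
Arguments phi {c} i b.
Arguments wt {c} b.

(* Kashiwara's axioms *)
Definition is_crystal (B : crystal) : Prop :=
  [/\ forall i (b : B), phi i b = eps i b + (wt b) 0 i,
      forall i (b b' : B), e i b = Some b' ->
        [/\ wt b' = wt b + alpha i, eps i b' = eps i b - 1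
          & phi i b' = phi i b + 1],
      forall i (b b' : B), f i b = Some b' ->
        [/\ wt b' = wt b - alpha i, eps i b' = eps i b + 1
          & phi i b' = phi i b - 1]
    & forall i (b b' : B), f i b = Some b' <-> e i b' = Some b].

Definition epsw (B : crystal) (b : B) : Pcl := \row_i eps i b.
Definition phiw (B : crystal) (b : B) : Pcl := \row_i phi i b.

(* T_la (x) B (x) T_mu, with t_la (x) b (x) t_mu represented by b *)
Definition TBT (la : Pcl) (B : crystal) (mu : Pcl) : crystal :=
  {| carrier := B;
     e := fun i (b : B) => e i b;
     f := fun i (b : B) => f i b;
     eps := fun i (b : B) => eps i b - la 0 i;
     phi := fun i (b : B) => phi i b + mu 0 i;
     wt := fun b : B => la + mu + wt b |}.

Definition embedding (B B' : crystal) (g : B -> B') : Prop :=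
  [/\ injective g,
      forall b, wt (g b) = wt b,
      forall i b, eps i (g b) = eps i b /\ phi i (g b) = phi i b,
      forall i b b', e i b = Some b' -> e i (g b) = Some (g b')
    & forall i b b', f i b = Some b' -> f i (g b) = Some (g b')].

(* (l, b) \in J.  A family is indexed by nat, but only its members of
   index l > 0 matter. *)
Definition inJ (B : nat -> crystal) (l : nat) (b : B l) : Prop :=
  (0 < l)%N /\ pair_c (epsw b) = l%:Z.

Definition is_limit (B : nat -> crystal) (Binf : crystal) (binf : Binf) : Prop :=
  [/\ forall l, (0 < l)%N -> is_crystal (B l),
      is_crystal Binf,
      [/\ wt binf = 0, epsw binf = 0 & phiw binf = 0]
    & exists F : forall l (b : B l), TBT (epsw b) (B l) (- phiw b) -> Binf,
        (forall l (b : B l), inJ b -> embedding (F l b) /\ F l b b = binf) /\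
        (forall x : Binf, exists l (b : B l), inJ b /\ exists y, F l b y = x)].

Definition coherent_family (B : nat -> crystal) : Prop :=
  exists (Binf : crystal) (binf : Binf), is_limit B binf.

(* (x1, x2, x3, \bar x3, \bar x2, \bar x1), with y for \bar x *)
Record coord := Coord { x1 : int; x2 : int; x3 : int; y3 : int; y2 : int; y1 : int }.

Definition parity (b : coord) : bool := (x3 b == y3 b %[mod 2])%Z.

(* The halves here and in [z4], [epsI], [phiI] are exact under [parity]. *)
Definition s (b : coord) : int :=
  x1 b + x2 b + ((x3 b + y3 b) %/ 2)%Z + y2 b + y1 b.

Definition z1 b := y1 b - x1 b.
Definition z2 b := y2 b - y3 b.
Definition z3 b := x3 b - x2 b.
Definition z4 b := ((y3 b - x3 b) %/ 2)%Z.

Definition A b : seq int :=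
  [:: 0;
      z1 b;
      z1 b + z2 b;
      z1 b + z2 b + 3 * z4 b;
      z1 b + z2 b + z3 b + 3 * z4 b;
      2 * z1 b + z2 b + z3 b + 3 * z4 b].

(* A_1 = 0, so 0 is a harmless default. *)
Definition maxA b : int := \big[Num.max/0]_(a <- A b) a.

(* Smallest and largest index of the maximum, counted from 0 as in [seq]. *)
Definition kmin b : nat := index (maxA b) (A b).
Definition kmax b : nat := 5 - index (maxA b) (rev (A b)).

Definition f0 (b : coord) : coord :=
  let: Coord x1 x2 x3 y3 y2 y1 := b in
  match kmin b with
  | 0%N => Coord (x1 + 1) x2 x3 y3 y2 y1
  | 1%N => Coord x1 x2 (x3 + 1) (y3 + 1) y2 (y1 - 1)
  | 2%N => Coord x1 x2 (x3 + 2) y3 (y2 - 1) y1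
  | 3%N => Coord x1 (x2 + 1) x3 (y3 - 2) y2 y1
  | 4%N => Coord (x1 + 1) x2 (x3 - 1) (y3 - 1) y2 y1
  | _ => Coord x1 x2 x3 y3 y2 (y1 - 1)
  end.

Definition e0 (b : coord) : coord :=
  let: Coord x1 x2 x3 y3 y2 y1 := b in
  match kmax b with
  | 0%N => Coord (x1 - 1) x2 x3 y3 y2 y1
  | 1%N => Coord x1 x2 (x3 - 1) (y3 - 1) y2 (y1 + 1)
  | 2%N => Coord x1 x2 (x3 - 2) y3 (y2 + 1) y1
  | 3%N => Coord x1 (x2 - 1) x3 (y3 + 2) y2 y1
  | 4%N => Coord (x1 - 1) x2 (x3 + 1) (y3 + 1) y2 y1
  | _ => Coord x1 x2 x3 y3 y2 (y1 + 1)
  end.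

(* The last branch is the case (\bar x2 - \bar x3)_+ < x2 - x3. *)
Definition e1 (b : coord) : coord :=
  let: Coord x1 x2 x3 y3 y2 y1 := b in
  if posp (x2 - x3) <= y2 - y3 then Coord x1 x2 x3 y3 (y2 + 1) (y1 - 1)
  else if y2 - y3 < 0 <= x3 - x2 then Coord x1 x2 (x3 + 1) (y3 - 1) y2 y1
  else Coord (x1 + 1) (x2 - 1) x3 y3 y2 y1.

(* The last branch is the case \bar x2 - \bar x3 > (x2 - x3)_+. *)
Definition f1 (b : coord) : coord :=
  let: Coord x1 x2 x3 y3 y2 y1 := b in
  if posp (y2 - y3) <= x2 - x3 then Coord (x1 - 1) (x2 + 1) x3 y3 y2 y1
  else if y2 - y3 <= 0 < x3 - x2 then Coord x1 x2 (x3 - 1) (y3 + 1) y2 y1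
  else Coord x1 x2 x3 y3 (y2 - 1) (y1 + 1).

Definition e2 (b : coord) : coord :=
  let: Coord x1 x2 x3 y3 y2 y1 := b in
  if x3 <= y3 then Coord x1 x2 x3 (y3 + 2) (y2 - 1) y1
  else Coord x1 (x2 + 1) (x3 - 2) y3 y2 y1.

Definition f2 (b : coord) : coord :=
  let: Coord x1 x2 x3 y3 y2 y1 := b in
  if y3 <= x3 then Coord x1 (x2 - 1) (x3 + 2) y3 y2 y1
  else Coord x1 x2 x3 (y3 - 2) (y2 + 1) y1.

Definition ruleE (i : 'I_3) : coord -> coord :=
  match val i with 0%N => e0 | 1%N => e1 | _ => e2 end.
Definition ruleF (i : 'I_3) : coord -> coord :=
  match val i with 0%N => f0 | 1%N => f1 | _ => f2 end.

Lemma ruleE_parity i b : parity b -> parity (ruleE i b).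
Proof.
rewrite /ruleE /parity; case: b => a1 a2 a3 b3 b2 b1 /=.
case: (val i) => [|[|k]] /=; rewrite /e0 /e1 /e2.
- by case: (kmax _) => [|[|[|[|[|k]]]]] /=; lia.
- by do 2?[case: ifP => _] => /=; lia.
- by case: ifP => _ /=; lia.
Qed.

Lemma ruleF_parity i b : parity b -> parity (ruleF i b).
Proof.
rewrite /ruleF /parity; case: b => a1 a2 a3 b3 b2 b1 /=.
case: (val i) => [|[|k]] /=; rewrite /f0 /f1 /f2.
- by case: (kmin _) => [|[|[|[|[|k]]]]] /=; lia.
- by do 2?[case: ifP => _] => /=; lia.
- by case: ifP => _ /=; lia.
Qed.

Definition inB (l : nat) (b : coord) : bool :=
  [&& 0 <= x1 b, 0 <= x2 b, 0 <= x3 b, 0 <= y3 b, 0 <= y2 b, 0 <= y1 b,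
      parity b & s b <= l%:Z].

Section Bl.
Variable l : nat.

Definition Bl := {b : coord | inB l b}.

Definition eB (i : 'I_3) (b : Bl) : option Bl := insub (ruleE i (val b)).
Definition fB (i : 'I_3) (b : Bl) : option Bl := insub (ruleF i (val b)).

(* [epow i b k] holds iff \tilde e_i^k b <> 0; similarly for [fpow]. *)
Definition epow i (b : Bl) (k : nat) : bool := iter k (obind (eB i)) (Some b).
Definition fpow i (b : Bl) (k : nat) : bool := iter k (obind (fB i)) (Some b).

(* \tilde e_i adds 1 to [ht i], \tilde f_i subtracts 1 from it, and [ht i] is
   bounded on B_l; hence the strings are finite. *)
Definition ht (i : 'I_3) (b : coord) : int :=
  match val i with
  | 0%N => y1 b - x1 b + y2 b - x2 b
  | 1%N => x1 b + x3 b - y1 b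
  | _ => x2 b - y2 b
  end.

Lemma ht_bound i (b : Bl) : - l%:Z <= ht i (val b) <= 2 * l%:Z.
Proof.
case: b => -[a1 a2 a3 b3 b2 b1]; rewrite /inB /parity /s /ht /= => H.
by case: (val i) => [|[|k]] /=; lia.
Qed.

Lemma ht_ruleE i b : ht i (ruleE i b) = ht i b + 1.
Proof.
case: b => a1 a2 a3 b3 b2 b1; rewrite /ruleE /ht.
case: (val i) => [|[|k]] /=; rewrite /e0 /e1 /e2.
- by case: (kmax _) => [|[|[|[|[|k]]]]] /=; lia.
- by do 2?[case: ifP => _] => /=; lia.
- by case: ifP => _ /=; lia.
Qed.

Lemma ht_ruleF i b : ht i (ruleF i b) = ht i b - 1.
Proof.
case: b => a1 a2 a3 b3 b2 b1; rewrite /ruleF /ht.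
case: (val i) => [|[|k]] /=; rewrite /f0 /f1 /f2.
- by case: (kmin _) => [|[|[|[|[|k]]]]] /=; lia.
- by do 2?[case: ifP => _] => /=; lia.
- by case: ifP => _ /=; lia.
Qed.

Lemma epow_ht i b k b' :
  iter k (obind (eB i)) (Some b) = Some b' ->
  ht i (val b') = ht i (val b) + k%:Z.
Proof.
elim: k b' => [|k IH] b' /=; first by case=> <-; lia.
case E: (iter k _ _) => [c|] //=; rewrite /eB.
case: insubP => // u _ Eu [<-]; rewrite Eu ht_ruleE (IH _ E) /=; lia.
Qed.

Lemma fpow_ht i b k b' :
  iter k (obind (fB i)) (Some b) = Some b' ->
  ht i (val b') = ht i (val b) - k%:Z.
Proof.
elim: k b' => [|k IH] b' /=; first by case=> <-; lia.
case E: (iter k _ _) => [c|] //=; rewrite /fB.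
case: insubP => // u _ Eu [<-]; rewrite Eu ht_ruleF (IH _ E) /=; lia.
Qed.

Lemma epow0 i b : exists k, epow i b k. Proof. by exists 0%N. Qed.
Lemma fpow0 i b : exists k, fpow i b k. Proof. by exists 0%N. Qed.

Lemma epow_bound i b k : epow i b k -> (k <= 3 * l)%N.
Proof.
rewrite /epow; case E: (iter _ _ _) => [b'|] // _.
have := epow_ht E; have := ht_bound i b; have := ht_bound i b'; lia.
Qed.

Lemma fpow_bound i b k : fpow i b k -> (k <= 3 * l)%N.
Proof.
rewrite /fpow; case E: (iter _ _ _) => [b'|] // _.
have := fpow_ht E; have := ht_bound i b; have := ht_bound i b'; lia.
Qed.

Definition epsB (i : 'I_3) (b : Bl) : nat := ex_maxn (epow0 i b) (@epow_bound i b).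
Definition phiB (i : 'I_3) (b : Bl) : nat := ex_maxn (fpow0 i b) (@fpow_bound i b).

Definition crystalB : crystal :=
  {| carrier := Bl;
     e := eB;
     f := fB;
     eps := fun i b => (epsB i b)%:Z;
     phi := fun i b => (phiB i b)%:Z;
     wt := fun b => \row_i ((phiB i b)%:Z - (epsB i b)%:Z) |}.

End Bl.

Definition Binf := {b : coord | parity b}.

Definition eI (i : 'I_3) (b : Binf) : Binf :=
  exist _ (ruleE i (val b)) (ruleE_parity i (valP b)).
Definition fI (i : 'I_3) (b : Binf) : Binf :=
  exist _ (ruleF i (val b)) (ruleF_parity i (valP b)).

Definition epsI (i : 'I_3) (b : coord) : int :=
  match val i with
  | 0%N => - s b + maxA b - (2 * z1 b + z2 b + z3 b + 3 * z4 b)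
  | 1%N => y1 b + posp (y3 b - y2 b + posp (x2 b - x3 b))
  | _ => y2 b + (posp (x3 b - y3 b) %/ 2)%Z
  end.

Definition phiI (i : 'I_3) (b : coord) : int :=
  match val i with
  | 0%N => - s b + maxA b
  | 1%N => x1 b + posp (x3 b - x2 b + posp (y2 b - y3 b))
  | _ => x2 b + (posp (y3 b - x3 b) %/ 2)%Z
  end.

Definition crystalBinf : crystal :=
  {| carrier := Binf;
     e := fun i b => Some (eI i b);
     f := fun i b => Some (fI i b);
     eps := fun i b => epsI i (val b);
     phi := fun i b => phiI i (val b);
     wt := fun b => \row_i (phiI i (val b) - epsI i (val b)) |}.

Definition binf : crystalBinf := exist parity (Coord 0 0 0 0 0 0) isT.

(* Main.v *)
(* On B_oo the operators and z_1, ..., z_4 depend on coordinates only through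
   differences, and on B_l the functions eps_i, phi_i are those of B_oo, with l
   added when i = 0: the operator e_i stays in B_l exactly as long as this value
   is positive.  The minimal elements of B_l are the m = (a, c, c, c, c, a); they
   satisfy z_j(m) = 0 for all j, so y |-> y - m commutes with all operators and
   changes eps_i and phi_i by the constants eps_i(m) = phi_i(m), which is what
   tensoring with T_{eps(m)} and T_{-phi(m)} compensates.  An element x of B_oo is
   reached by taking c large and then l large, so that x + m is in B_l. *)
From mathcomp Require Import all_boot all_order all_algebra.
From mathcomp Require Import zify.

Set Implicit Arguments.
Unset Strict Implicit.
Unset Printing Implicit Defensive.

Import Order.TTheory GRing.Theory Num.Theory.
Require Import Defs.
Local Open Scope ring_scope.

(** * The maximum of [A] and its first and last positions *)

Lemma maxA_in b : maxA b \in A b.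
Proof. by rewrite /maxA /A !big_cons big_nil /= !inE; lia. Qed.

Lemma maxA_has b : has (fun a => a == maxA b) (A b).
Proof. by apply/hasP; exists (maxA b); rewrite ?maxA_in. Qed.

Lemma maxA_ge b : all (fun a => a <= maxA b) (A b).
Proof. by rewrite /maxA /A !big_cons big_nil /=; lia. Qed.

Lemma index_all_lt (m : int) (r : seq int) :
  all (fun a => a <= m) r -> all (fun a => a < m) (take (index m r) r).
Proof.
elim: r => //= a r IHr /andP[le_am le_rm].
by case: eqP => //= ne_am; rewrite IHr // andbT; lia.
Qed.

(** Turns the choice of branch in [f0] into linear inequalities between [maxA b] and the entries of
    [A b]; [kmaxP] does the same for [e0]. *)
Lemma kminP b :
  [/\ (kmin b < 6)%N, (A b)`_(kmin b) = maxA b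
    & all (fun a => a < maxA b) (take (kmin b) (A b))].
Proof.
split; first by rewrite [X in (_ < X)%N](_ : _ = size (A b)) // index_mem maxA_in.
  by rewrite nth_index ?maxA_in.
by rewrite index_all_lt ?maxA_ge.
Qed.

Lemma kmaxP b :
  [/\ (kmax b < 6)%N, (A b)`_(kmax b) = maxA b
    & all (fun a => a < maxA b) (drop (kmax b).+1 (A b))].
Proof.
have lt6 : (index (maxA b) (rev (A b)) < size (A b))%N.
  by rewrite -size_rev index_mem mem_rev maxA_in.
(* The last maximum of [A b] is the first one of the reversed list. *)
have := index_all_lt (etrans (all_rev _ _) (maxA_ge b)).
rewrite take_rev all_rev /kmax; set k := index _ _ in lt6 * => lt_drop.
have lt6' : (k < 6)%N by [].
split; first by lia.
  rewrite -[A b]revK nth_rev size_rev (_ : size (A b) = 6)%N //; last by lia.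
  by rewrite (_ : (6 - _)%N = k) ?nth_index ?mem_rev ?maxA_in //; lia.
by rewrite (_ : (5 - k).+1 = size (A b) - k)%N //= ; lia.
Qed.

(** * Operators, string functions and weights on B_oo *)

(** The pairing of h_j with the weight. All positive parts and maxima cancel in phi_j - eps_j,
    leaving a form linear in the coordinates and [z4]; for j = 0 it is the last entry A_6. *)
Definition linwt (j : nat) b : int :=
  match j with
  | 0%N => 2 * z1 b + z2 b + z3 b + 3 * z4 b
  | 1%N => x1 b - y1 b + z3 b + z2 b
  | _ => x2 b - y2 b + z4 b
  end.

Lemma phi_sub_eps i b : parity b -> phiI i b - epsI i b = linwt i b.
Proof.
case: b => a1 a2 a3 b3 b2 b1; rewrite /parity /phiI /epsI /linwt /=.
case: i => [[|[|k]]] /= _; rewrite /z1 /z2 /z3 /z4 /posp /=; lia.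
Qed.

(** [maxA] is not unfolded: the facts about it must be put in the context beforehand. *)
Ltac coord_lia :=
  unfold inB, parity, linwt, epsI, phiI, s, A, z1, z2, z3, z4, posp in *;
  simpl in *; lia.

(** This is the drop of eps_0 by 1 under [e0], solved for the new maximum. In each branch that
    maximum is pinned down as an upper bound of the new list that also occurs in it. *)
Lemma maxA_e0 b : parity b ->
  maxA (e0 b) = maxA b - 1 + s (e0 b) - s b + linwt 0 (e0 b) - linwt 0 b.
Proof.
case: b => a1 a2 a3 b3 b2 b1 par_b.
have [] := kmaxP (Coord a1 a2 a3 b3 b2 b1).
have := maxA_ge (Coord a1 a2 a3 b3 b2 b1).
rewrite /e0; case: (kmax _) => [|[|[|[|[|[|k]]]]]] // geM _ eqM ltM.
all: match goal with |- maxA ?x = _ =>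
  have := maxA_ge x; have := maxA_has x end; move=> *; coord_lia.
Qed.

(** Likewise the drop of phi_0 by 1 under [f0]. *)
Lemma maxA_f0 b : parity b -> maxA (f0 b) = maxA b - 1 + s (f0 b) - s b.
Proof.
case: b => a1 a2 a3 b3 b2 b1 par_b.
have [] := kminP (Coord a1 a2 a3 b3 b2 b1).
have := maxA_ge (Coord a1 a2 a3 b3 b2 b1).
rewrite /f0; case: (kmin _) => [|[|[|[|[|[|k]]]]]] // geM _ eqM ltM.
all: match goal with |- maxA ?x = _ =>
  have := maxA_ge x; have := maxA_has x end; move=> *; coord_lia.
Qed.

Lemma e0K b : parity b -> f0 (e0 b) = b.
Proof.
move=> par_b; have := maxA_e0 par_b; case: b par_b => a1 a2 a3 b3 b2 b1 par_b.
have [] := kmaxP (Coord a1 a2 a3 b3 b2 b1).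
have := maxA_ge (Coord a1 a2 a3 b3 b2 b1).
rewrite /e0; case: (kmax _) => [|[|[|[|[|[|k]]]]]] // geM _ eqM ltM eqM'.
(* The first maximum after [e0] sits where the last one was before, so of the 36 pairs of branches
   only the diagonal ones are consistent. *)
all: match goal with |- f0 ?x = _ =>
  have := maxA_ge x; have [] := kminP x end; rewrite /f0;
  case: (kmin _) => [|[|[|[|[|[|k]]]]]] // *; try (f_equal; lia); exfalso.
all: coord_lia.
Qed.

Lemma f0K b : parity b -> e0 (f0 b) = b.
Proof.
move=> par_b; have := maxA_f0 par_b; case: b par_b => a1 a2 a3 b3 b2 b1 par_b.
have [] := kminP (Coord a1 a2 a3 b3 b2 b1).
have := maxA_ge (Coord a1 a2 a3 b3 b2 b1).
rewrite /f0; case: (kmin _) => [|[|[|[|[|[|k]]]]]] // geM _ eqM ltM eqM'.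
all: match goal with |- e0 ?x = _ =>
  have := maxA_ge x; have [] := kmaxP x end; rewrite /e0;
  case: (kmax _) => [|[|[|[|[|[|k]]]]]] // *; try (f_equal; lia); exfalso.
all: coord_lia.
Qed.

Lemma ruleEK i b : parity b -> ruleF i (ruleE i b) = b.
Proof.
rewrite /ruleE /ruleF; case: (val i) => [|[|k]]; first exact: e0K.
  case: b => a1 a2 a3 b3 b2 b1 par_b; rewrite /e1 /f1.
  by do 2?[case: ifP => ?]; do 2?[case: ifP => ?];
    (f_equal; lia) || (exfalso; coord_lia).
case: b => a1 a2 a3 b3 b2 b1 par_b; rewrite /e2 /f2.
by case: ifP => ?; case: ifP => ?; (f_equal; lia) || (exfalso; coord_lia).
Qed.

Lemma ruleFK i b : parity b -> ruleE i (ruleF i b) = b.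
Proof.
rewrite /ruleE /ruleF; case: (val i) => [|[|k]]; first exact: f0K.
  case: b => a1 a2 a3 b3 b2 b1 par_b; rewrite /e1 /f1.
  by do 2?[case: ifP => ?]; do 2?[case: ifP => ?];
    (f_equal; lia) || (exfalso; coord_lia).
case: b => a1 a2 a3 b3 b2 b1 par_b; rewrite /e2 /f2.
by case: ifP => ?; case: ifP => ?; (f_equal; lia) || (exfalso; coord_lia).
Qed.

Lemma epsI_ruleE i b : parity b -> epsI i (ruleE i b) = epsI i b - 1.
Proof.
rewrite /ruleE /epsI; case: (val i) => [|[|k]].
- by move=> par_b; rewrite maxA_e0 // /linwt; lia.
- case: b => a1 a2 a3 b3 b2 b1 par_b; rewrite /e1.
  by do 2?[case: ifP => ?]; coord_lia.
case: b => a1 a2 a3 b3 b2 b1 par_b; rewrite /e2.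
by case: ifP => ?; coord_lia.
Qed.

(** Follows from [epsI_ruleE] at [ruleF i b], as the two rules are inverse. *)
Lemma epsI_ruleF i b : parity b -> epsI i (ruleF i b) = epsI i b + 1.
Proof.
move=> par_b; rewrite -{2}(ruleFK i par_b) epsI_ruleE ?ruleF_parity //; lia.
Qed.

Lemma phiI_ruleF i b : parity b -> phiI i (ruleF i b) = phiI i b - 1.
Proof.
rewrite /ruleF /phiI; case: (val i) => [|[|k]].
- by move=> par_b; rewrite maxA_f0 //; lia.
- case: b => a1 a2 a3 b3 b2 b1 par_b; rewrite /f1.
  by do 2?[case: ifP => ?]; coord_lia.
case: b => a1 a2 a3 b3 b2 b1 par_b; rewrite /f2.
by case: ifP => ?; coord_lia.
Qed.

Lemma phiI_ruleE i b : parity b -> phiI i (ruleE i b) = phiI i b + 1.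
Proof.
move=> par_b; rewrite -{2}(ruleEK i par_b) phiI_ruleF ?ruleE_parity //; lia.
Qed.

(** All branches of a rule shift the weight by the same root, so nothing about [maxA] is called
    upon. *)
Lemma linwt_ruleE (i j : 'I_3) b : parity b ->
  linwt j (ruleE i b) = linwt j b + cartan j i.
Proof.
rewrite /ruleE mxE.
case: i j => [[|[|[|//]]] ?] [[|[|[|//]]] ?] /=;
  case: b => a1 a2 a3 b3 b2 b1 par_b; rewrite /e0 /e1 /e2.
all: try (case: (kmax _) => [|[|[|[|[|k]]]]]); do 2?[case: ifP => ?].
all: coord_lia.
Qed.

Lemma linwt_ruleF (i j : 'I_3) b : parity b ->
  linwt j (ruleF i b) = linwt j b - cartan j i.
Proof.
move=> par_b; rewrite -{2}(ruleFK i par_b) linwt_ruleE ?ruleF_parity //; lia.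
Qed.

(** * String lengths in B_l *)

Definition level_shift (l : nat) (i : 'I_3) : int :=
  if val i == 0%N then l%:Z else 0.

(** For i = 0 the value is the sum of [l - s b] and [maxA b] - A_6, both nonnegative. *)
Lemma epsI_ge0 l i b : inB l b -> 0 <= epsI i b + level_shift l i.
Proof.
rewrite /epsI /level_shift; case: b => a1 a2 a3 b3 b2 b1 in_b.
have := maxA_ge (Coord a1 a2 a3 b3 b2 b1).
by case: (val i) => [|[|k]] *; coord_lia.
Qed.

Lemma phiI_ge0 l i b : inB l b -> 0 <= phiI i b + level_shift l i.
Proof.
rewrite /phiI /level_shift; case: b => a1 a2 a3 b3 b2 b1 in_b.
have := maxA_ge (Coord a1 a2 a3 b3 b2 b1).
by case: (val i) => [|[|k]] *; coord_lia.
Qed.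

(** For i = 0, if the last maximum lies before A_6, both sides hold: the strict inequalities after
    it make the lowered coordinates large enough, and [s] does not grow. If it lies at A_6, the rule
    raises [s] by 1 and the value is [l - s b]. *)
Lemma inB_ruleE l i b : inB l b ->
  inB l (ruleE i b) = (0 < epsI i b + level_shift l i).
Proof.
rewrite /ruleE /epsI /level_shift; case: b => a1 a2 a3 b3 b2 b1 in_b.
case: (val i) => [|[|k]]; rewrite /e0 /e1 /e2.
- have [] := kmaxP (Coord a1 a2 a3 b3 b2 b1).
  have := maxA_ge (Coord a1 a2 a3 b3 b2 b1).
  by case: (kmax _) => [|[|[|[|[|[|k]]]]]] // geM _ eqM ltM; coord_lia.
- by do 2?[case: ifP => ?]; coord_lia.
by case: ifP => ?; coord_lia.
Qed.

(** Mirror image of [inB_ruleE], with A_1 in the role of A_6. *)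
Lemma inB_ruleF l i b : inB l b ->
  inB l (ruleF i b) = (0 < phiI i b + level_shift l i).
Proof.
rewrite /ruleF /phiI /level_shift; case: b => a1 a2 a3 b3 b2 b1 in_b.
case: (val i) => [|[|k]]; rewrite /f0 /f1 /f2.
- have [] := kminP (Coord a1 a2 a3 b3 b2 b1).
  have := maxA_ge (Coord a1 a2 a3 b3 b2 b1).
  by case: (kmin _) => [|[|[|[|[|[|k]]]]]] // geM _ eqM ltM; coord_lia.
- by do 2?[case: ifP => ?]; coord_lia.
by case: ifP => ?; coord_lia.
Qed.

Lemma inB_parity l b : inB l b -> parity b.
Proof. by case/and5P=> _ _ _ _ /and4P[]. Qed.

Lemma iter_obind_None (T : Type) (g : T -> option T) k :
  iter k (obind g) None = None.
Proof. by elim: k => //= k ->. Qed.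

(** By induction, peeling off the first application: it is defined iff the value is positive, and it
    lowers the value by 1. *)
Lemma epowE l i (b : Bl l) k :
  epow i b k = (k%:Z <= epsI i (val b) + level_shift l i).
Proof.
rewrite /epow; elim: k b => [|k IHk] b.
  by rewrite epsI_ge0 ?(valP b).
rewrite iterSr [obind _ _]/= /eB; case: insubP => [c|].
  rewrite inB_ruleE ?(valP b) // => lt0 Ec.
  rewrite IHk Ec epsI_ruleE //; first lia.
  exact: inB_parity (valP b).
rewrite inB_ruleE ?(valP b) // iter_obind_None [LHS]/=; lia.
Qed.

Lemma fpowE l i (b : Bl l) k :
  fpow i b k = (k%:Z <= phiI i (val b) + level_shift l i).
Proof.
rewrite /fpow; elim: k b => [|k IHk] b.
  by rewrite phiI_ge0 ?(valP b).
rewrite iterSr [obind _ _]/= /fB; case: insubP => [c|].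
  rewrite inB_ruleF ?(valP b) // => lt0 Ec.
  rewrite IHk Ec phiI_ruleF //; first lia.
  exact: inB_parity (valP b).
rewrite inB_ruleF ?(valP b) // iter_obind_None [LHS]/=; lia.
Qed.

Lemma epsBE l i (b : Bl l) :
  (epsB i b)%:Z = epsI i (val b) + level_shift l i.
Proof.
have := epsI_ge0 i (valP b); rewrite /epsB.
case: ex_maxnP => k; rewrite epowE => lek maxk ge0.
have := maxk (absz (epsI i (val b) + level_shift l i)); rewrite epowE; lia.
Qed.

Lemma phiBE l i (b : Bl l) :
  (phiB i b)%:Z = phiI i (val b) + level_shift l i.
Proof.
have := phiI_ge0 i (valP b); rewrite /phiB.
case: ex_maxnP => k; rewrite fpowE => lek maxk ge0.
have := maxk (absz (phiI i (val b) + level_shift l i)); rewrite fpowE; lia.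
Qed.

(** * Kashiwara's axioms for B_l and B_oo *)

Lemma wt_crystalB l (b : crystalB l) j : (wt b) 0 j = linwt j (val b).
Proof.
by rewrite mxE epsBE phiBE -phi_sub_eps ?(inB_parity (valP b)) //; lia.
Qed.

Lemma wt_crystalBinf (b : crystalBinf) j : (wt b) 0 j = linwt j (val b).
Proof. by rewrite mxE phi_sub_eps ?(valP b). Qed.

Lemma eB_Some l i (b b' : Bl l) : eB i b = Some b' <-> ruleE i (val b) = val b'.
Proof.
rewrite /eB; split=> [|->]; last by rewrite valK.
by case: insubP => // c _ Ec [<-].
Qed.

Lemma fB_Some l i (b b' : Bl l) : fB i b = Some b' <-> ruleF i (val b) = val b'.
Proof.
rewrite /fB; split=> [|->]; last by rewrite valK.
by case: insubP => // c _ Ec [<-].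
Qed.

Lemma is_crystal_crystalB l : is_crystal (crystalB l).
Proof.
split=> [i b|i b b' /eB_Some Eb'|i b b' /fB_Some Eb'|i b b'].
- by rewrite mxE addrC subrK.
- have par_b := inB_parity (valP b); split.
  + apply/rowP=> j; rewrite wt_crystalB [RHS]mxE wt_crystalB -Eb'.
    by rewrite linwt_ruleE // [alpha i 0 j]mxE.
  + by rewrite /= !epsBE -Eb' epsI_ruleE //; lia.
  by rewrite /= !phiBE -Eb' phiI_ruleE //; lia.
- have par_b := inB_parity (valP b); split.
  + apply/rowP=> j; rewrite wt_crystalB [RHS]mxE wt_crystalB -Eb'.
    by rewrite linwt_ruleF // [(- alpha i) 0 j]mxE [alpha i 0 j]mxE.
  + by rewrite /= !epsBE -Eb' epsI_ruleF //; lia.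
  by rewrite /= !phiBE -Eb' phiI_ruleF //; lia.
split=> [/fB_Some|/eB_Some] Eb; [apply/eB_Some|apply/fB_Some].
  by rewrite -Eb ruleFK ?(inB_parity (valP b)).
by rewrite -Eb ruleEK ?(inB_parity (valP b')).
Qed.

Lemma is_crystal_crystalBinf : is_crystal crystalBinf.
Proof.
split=> [i b|i b _ [<-]|i b _ [<-]|i b b'].
- by rewrite mxE addrC subrK.
- have par_b := valP b; split.
  + apply/rowP=> j; rewrite wt_crystalBinf [RHS]mxE wt_crystalBinf.
    by rewrite linwt_ruleE // [alpha i 0 j]mxE.
  + exact: epsI_ruleE.
  exact: phiI_ruleE.
- have par_b := valP b; split.
  + apply/rowP=> j; rewrite wt_crystalBinf [RHS]mxE wt_crystalBinf.
    by rewrite linwt_ruleF // [(- alpha i) 0 j]mxE [alpha i 0 j]mxE.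
  + exact: epsI_ruleF.
  exact: phiI_ruleF.
split=> -[<-]; congr Some; apply: val_inj; first exact: (ruleFK i (valP b)).
exact: (ruleEK i (valP b')).
Qed.

(** * Translation by minimal elements *)

Definition coord_sub (b m : coord) : coord :=
  Coord (x1 b - x1 m) (x2 b - x2 m) (x3 b - x3 m)
        (y3 b - y3 m) (y2 b - y2 m) (y1 b - y1 m).

Lemma parity_sub b m : parity b -> parity m -> parity (coord_sub b m).
Proof. by rewrite /parity /=; lia. Qed.

Definition balanced (m : coord) : bool :=
  [&& x1 m == y1 m, x2 m == x3 m, x3 m == y3 m & y3 m == y2 m].

(** The pairing minus l equals (max A - z_1) + (z_2 + 2 max(0, -z_2, -z_2 - z_3)) + 3 max(0, -z_4).
    The three terms are nonnegative, so they vanish: max A = z_1, z_2 = 0 and z_3, z_4 >= 0.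
    Comparing z_1 with the other entries of A then makes every z_j zero. *)
Lemma balanced_min l (b : Bl l) : pair_c (epsw (b : crystalB l)) = l%:Z ->
  balanced (val b).
Proof.
rewrite /pair_c !big_ord_recl big_ord0 !mxE /= !epsBE /epsI /level_shift.
have := inB_parity (valP b); have := maxA_ge (val b).
case: b => -[a1 a2 a3 b3 b2 b1] in_b *; rewrite /balanced; coord_lia.
Qed.

Lemma balanced_eps_phi m i : balanced m -> epsI i m = phiI i m.
Proof.
case: m => a1 a2 a3 b3 b2 b1; rewrite /balanced /= => bal_m.
have : parity (Coord a1 a2 a3 b3 b2 b1) by rewrite /parity /=; lia.
move/(phi_sub_eps i); rewrite (_ : linwt _ _ = 0); first lia.
by case: i => [[|[|k]]] ? ; coord_lia.
Qed.

Lemma A_sub b m : balanced m -> A (coord_sub b m) = A b.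
Proof.
case: b m => [a1 a2 a3 b3 b2 b1] [c1 c2 c3 d3 d2 d1].
rewrite /balanced /= => bal_m.
by rewrite /A /z1 /z2 /z3 /z4 /=; do !congr (_ :: _); lia.
Qed.

Lemma maxA_sub b m : balanced m -> maxA (coord_sub b m) = maxA b.
Proof. by move=> bal_m; rewrite /maxA A_sub. Qed.

Lemma kmin_sub b m : balanced m -> kmin (coord_sub b m) = kmin b.
Proof. by move=> bal_m; rewrite /kmin maxA_sub ?A_sub. Qed.

Lemma kmax_sub b m : balanced m -> kmax (coord_sub b m) = kmax b.
Proof. by move=> bal_m; rewrite /kmax maxA_sub ?A_sub. Qed.

Lemma ruleE_sub i b m : balanced m ->
  ruleE i (coord_sub b m) = coord_sub (ruleE i b) m.
Proof.
move=> bal_m; rewrite /ruleE; case: (val i) => [|[|k]].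
- have := kmax_sub b bal_m.
  case: b => a1 a2 a3 b3 b2 b1; rewrite /e0 /coord_sub /= => ->.
  by case: (kmax _) => [|[|[|[|[|k]]]]]; rewrite /coord_sub /=; f_equal; lia.
- move: bal_m; case: b m => [a1 a2 a3 b3 b2 b1] [c1 c2 c3 d3 d2 d1].
  rewrite /balanced /e1 /coord_sub /= /posp => bal_m.
  by do 2?[case: ifP => ?]; do 2?[case: ifP => ?] => /=; f_equal; lia.
move: bal_m; case: b m => [a1 a2 a3 b3 b2 b1] [c1 c2 c3 d3 d2 d1].
rewrite /balanced /e2 /coord_sub /= => bal_m.
by case: ifP => ?; case: ifP => ? /=; f_equal; lia.
Qed.

Lemma ruleF_sub i b m : balanced m ->
  ruleF i (coord_sub b m) = coord_sub (ruleF i b) m.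
Proof.
move=> bal_m; rewrite /ruleF; case: (val i) => [|[|k]].
- have := kmin_sub b bal_m.
  case: b => a1 a2 a3 b3 b2 b1; rewrite /f0 /coord_sub /= => ->.
  by case: (kmin _) => [|[|[|[|[|k]]]]]; rewrite /coord_sub /=; f_equal; lia.
- move: bal_m; case: b m => [a1 a2 a3 b3 b2 b1] [c1 c2 c3 d3 d2 d1].
  rewrite /balanced /f1 /coord_sub /= /posp => bal_m.
  by do 2?[case: ifP => ?]; do 2?[case: ifP => ?] => /=; f_equal; lia.
move: bal_m; case: b m => [a1 a2 a3 b3 b2 b1] [c1 c2 c3 d3 d2 d1].
rewrite /balanced /f2 /coord_sub /= => bal_m.
by case: ifP => ?; case: ifP => ? /=; f_equal; lia.
Qed.

Lemma epsI_sub i b m : parity b -> balanced m ->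
  epsI i (coord_sub b m) = epsI i b - epsI i m.
Proof.
move=> par_b bal_m; rewrite /epsI (maxA_sub b bal_m).
(* All entries of [A m] are 0. *)
have -> : maxA m = 0.
  have := maxA_ge m; have := maxA_has m; move: bal_m; rewrite /balanced.
  by case: m => *; coord_lia.
move: par_b bal_m; rewrite /balanced.
case: b m => [a1 a2 a3 b3 b2 b1] [c1 c2 c3 d3 d2 d1].
by case: (val i) => [|[|k]] * /=; coord_lia.
Qed.

Lemma linwt_sub j b m : parity b -> balanced m ->
  linwt j (coord_sub b m) = linwt j b.
Proof.
rewrite /balanced; case: b m => [a1 a2 a3 b3 b2 b1] [c1 c2 c3 d3 d2 d1].
by case: j => [|[|k]] *; coord_lia.
Qed.

Lemma phiI_sub i b m : parity b -> balanced m ->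
  phiI i (coord_sub b m) = phiI i b - phiI i m.
Proof.
move=> par_b bal_m; have par_m : parity m.
  by move: bal_m; rewrite /balanced /parity; lia.
have := phi_sub_eps i (parity_sub par_b par_m); have := phi_sub_eps i par_b.
by have := balanced_eps_phi i bal_m; rewrite linwt_sub // epsI_sub //; lia.
Qed.

(** * The embeddings and the limit *)

(** Defined for every [m], since [is_limit] asks for a map at each element of B_l; the embedding
    property is proved for balanced [m]. *)
Definition shift l (m y : Bl l) : Binf :=
  exist parity (coord_sub (val y) (val m))
    (parity_sub (inB_parity (valP y)) (inB_parity (valP m))).

(** The [level_shift] terms of [y] and [m] cancel, so the level disappears in B_oo. *)
Lemma embedding_shift l (m : crystalB l) : balanced (val m) ->
  @embedding (TBT (epsw m) (crystalB l) (- phiw m)) crystalBinf (shift m).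
Proof.
move=> bal_m; split.
- move=> [[a1 a2 a3 b3 b2 b1] ?] [[c1 c2 c3 d3 d2 d1] ?] [] *.
  by apply: val_inj; congr Coord; lia.
- move=> y; apply/rowP=> j.
  rewrite wt_crystalBinf linwt_sub ?(inB_parity (valP y)) //.
  rewrite [RHS]mxE wt_crystalB !mxE [eps _ _]epsBE [phi _ _]phiBE.
  by rewrite balanced_eps_phi // subrr add0r.
- move=> i y; have par_y := inB_parity (valP y).
  split.
    rewrite -[LHS]/(epsI i (coord_sub (val y) (val m))) epsI_sub //.
    by rewrite -[RHS]/((epsB i y)%:Z - _) mxE [eps _ _]epsBE epsBE; lia.
  rewrite -[LHS]/(phiI i (coord_sub (val y) (val m))) phiI_sub //.
  by rewrite -[RHS]/((phiB i y)%:Z + _) !mxE [phi _ _]phiBE phiBE; lia.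
- move=> i y y' /eB_Some Ey; congr Some; apply: val_inj.
  by rewrite /= ruleE_sub ?Ey.
move=> i y y' /fB_Some Ey; congr Some; apply: val_inj.
by rewrite /= ruleF_sub ?Ey.
Qed.

Lemma is_limit_crystalBinf : is_limit crystalB binf.
Proof.
split.
- by move=> l _; apply: is_crystal_crystalB.
- exact: is_crystal_crystalBinf.
- have eps0 i : epsI i (val binf) = 0.
    rewrite /epsI /maxA /A !big_cons big_nil.
    by case: (val i) => [|[|k]].
  have phi0 i : phiI i (val binf) = 0 by rewrite -balanced_eps_phi ?eps0.
  by split; apply/rowP=> i; rewrite !mxE /= ?eps0 ?phi0.
exists (fun l m y => shift m y); split=> [l m [_ /balanced_min bal_m]|x].
  split; first exact: embedding_shift.
  by apply: val_inj; rewrite /= /coord_sub !subrr.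
case: x => -[a1 a2 a3 b3 b2 b1] par_x.
(* Adding N makes each coordinate nonnegative. With m = (N, ..., N), s(m) = 5N and s(x + m) <= 6N,
   both below l; the successor in l ensures l > 0. *)
pose N := (`|a1| + `|a2| + `|a3| + `|b3| + `|b2| + `|b1|)%N.
pose l := (11 * N).+1.
have in_m : inB l (Coord N N N N N N).
  by rewrite /inB /parity /s /=; lia.
have in_y : inB l (Coord (a1 + N) (a2 + N) (a3 + N) (b3 + N) (b2 + N) (b1 + N)).
  by rewrite /inB /s; move: par_x; rewrite /parity /=; lia.
pose m : Bl l := exist (inB l) _ in_m; exists l, m; split.
  (* Here eps_0(m) = l - 5N and eps_1(m) = eps_2(m) = N, so the pairing is l - 5N + 2N + 3N = l. *)
  split=> //; rewrite /pair_c !big_ord_recl big_ord0 !mxE /= !epsBE.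
  rewrite /epsI /level_shift /maxA /A !big_cons big_nil /=; coord_lia.
exists (exist (inB l) _ in_y); apply: val_inj; rewrite /= /coord_sub /=.
by f_equal; lia.
Qed.

Theorem mainTheorem5 : is_limit crystalB binf /\ coherent_family crystalB.
Proof.
split; first exact: is_limit_crystalBinf.
by exists crystalBinf, binf; apply: is_limit_crystalBinf.
Qed.
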